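(* Let $\mathcal{H}$ be a complex Hilbert space and let $T\in\mathcal{B}(\mathcal{H})$. Then for every $\alpha\in[0,1]$, $$\|T\|_{\alpha}^2\leq\left\|\left(1-\frac{3\alpha}{4}\right)|T|^2+\frac{\alpha}{4}|T^*|^2\right\|+\frac{\alpha}{2}\left\|\Re(|T||T^*|)\right\|$$ and $$\|T\|_{\alpha}^2\leq\left\|\left(1-\frac{3\alpha}{4}\right)|T^*|^2+\frac{\alpha}{4}|T|^2\right\|+\frac{\alpha}{2}\left\|\Re(|T||T^*|)\right\|.$$ Further, $$w(T)\leq\min\{\gamma,\delta\},$$ where $$\gamma=\min_{\alpha\in[0,1]}\left\{\left\|\left(1-\frac{3\alpha}{4}\right)|T|^2+\frac{\alpha}{4}|T^*|^2\right\|+\frac{\alpha}{2}\left\|\Re(|T||T^*|)\right\|\right\}^{1/2}$$ and $$\delta=\min_{\alpha\in[0,1]}\left\{\left\|\left(1-\frac{3\alpha}{4}\right)|T^*|^2+\frac{\alpha}{4}|T|^2\right\|+\frac{\alpha}{2}\left\|\Re(|T||T^*|)\right\|\right\}^{1/2}.$$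
   Context: $\mathcal{B}(\mathcal{H})$ denotes the $C^*$-algebra of all bounded linear operators on the complex Hilbert space $\mathcal{H}$, and $\|\cdot\|$ is the operator norm. For $T\in\mathcal{B}(\mathcal{H})$, $|T|=(T^*T)^{1/2}$, $|T^*|=(TT^* )^{1/2}$ and $\Re(T)=\frac12(T+T^* )$. The numerical radius is $w(T)=\sup\{|\langle Tx,x\rangle|: x\in\mathcal{H},\ \|x\|=1\}$. For $0\leq\alpha\leq1$ the $\alpha$-norm of $T$ is $$\|T\|_{\alpha}=\sup\left\{\sqrt{\alpha|\langle Tx,x\rangle|^2+(1-\alpha)\|Tx\|^2}: x\in\mathcal{H},\ \|x\|=1\right\}.$$ *)

(* Defs.v *)
From HB Require Import structures.
From mathcomp Require Import all_boot all_order all_algebra.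
From mathcomp Require Import complex.
From mathcomp Require Import all_classical all_reals all_analysis.

Set Implicit Arguments.
Unset Strict Implicit.
Unset Printing Implicit Defensive.

Import Order.TTheory GRing.Theory Num.Theory.
Import numFieldNormedType.Exports.

Local Open Scope classical_set_scope.
Local Open Scope complex_scope.
Local Open Scope ring_scope.

(* The inner product is linear in its first argument and conjugate-linear in
   the second one. It induces the norm of the space, which is complete. *)
HB.mixin Record CompleteNormedModule_isHilbert (R : realType) H
    of CompleteNormedModule R[i] H := {
  dot : {dot H for (@Num.conj R[i])} ;
  dot_norm : forall x : H, (dot : H -> H -> R[i]) x x = `|x| ^+ 2
}.

#[short(type="hilbertType")]
HB.structure Definition Hilbert (R : realType) :=
  {H of CompleteNormedModule R[i] H & CompleteNormedModule_isHilbert R H}.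

(* Norms over R[i] take their values in R[i]; [rnorm] is the same number,
   seen in R. It also applies to complex numbers, as the modulus. *)
Definition rnorm (R : realType) (V : normedZmodType R[i]) (x : V) : R :=
  complex.Re `|x|.

(* Operators are plain functions, so that sums and scalar multiples are the
   pointwise ones and products are compositions. *)
Section Operators.
Context {R : realType} {H : hilbertType R}.
Implicit Types (T S : H -> H) (x y : H).

Definition bounded_operator T :=
  linear T /\ exists M : R, forall x, rnorm (T x) <= M * rnorm x.

Definition unit_sphere : set H := [set x | rnorm x = 1].

(* The suprema below are 0 when the space is 0, since [sup set0 = 0]. *)
Definition opnorm T : R := sup [set rnorm (T x) | x in unit_sphere].

Definition numerical_radius T : R :=
  sup [set rnorm (dot (T x) x) | x in unit_sphere].

Definition alpha_norm (alpha : R) T : R :=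
  sup [set Num.sqrt (alpha * rnorm (dot (T x) x) ^+ 2
                     + (1 - alpha) * rnorm (T x) ^+ 2) | x in unit_sphere].

(* The adjoint of a bounded operator exists and is unique; likewise for the
   positive square root of a positive bounded operator. [xget] picks it, with
   the zero operator as a dummy value where there is none. *)
Definition adjoint T : H -> H :=
  xget (fun=> 0)
    [set S | bounded_operator S /\ forall x y, dot (T x) y = dot x (S y)].

(* The order on R[i] makes [0 <= z] mean that z is real and nonnegative. *)
Definition positive_operator T :=
  bounded_operator T /\ forall x, 0 <= dot (T x) x.

Definition sqrt_operator T : H -> H :=
  xget (fun=> 0) [set S | positive_operator S /\ S \o S = T].

Definition abs_operator T : H -> H := sqrt_operator (adjoint T \o T).

Definition real_part T : H -> H := (2^-1 : R[i]) *: (T + adjoint T).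

End Operators.

Definition is_minimum (R : realType) (A : set R) (m : R) := A m /\ lbound A m.

(* Main.v *)
(* Write P = |T| and Q = |T^*|. The mixed Schwarz inequality gives
   2 |<Tx,x>| <= <(P + Q)x,x> <= |(P + Q)x| for a unit vector x, and expanding
   |(P + Q)x|^2 = <P^2 x,x> + <Q^2 x,x> + 2 Re<PQx,x> bounds
   alpha |<Tx,x>|^2 + (1 - alpha) |Tx|^2 by the first right-hand side. Applied
   to T^* this bounds the alpha-norm of T^* by the second one; T and T^* have
   the same alpha-norm because each 2 x 2 compression of T is unitarily
   equivalent to its transpose. The numerical radius is at most every
   alpha-norm, and the minima exist since the bounds are Lipschitz in alpha. *)
Require Import Defs.
From mathcomp Require Import all_boot all_order all_algebra.
From mathcomp Require Import complex.
From mathcomp Require Import all_classical all_reals all_analysis.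
From mathcomp Require Import ring lra.

Import Order.TTheory GRing.Theory Num.Theory.
Import numFieldNormedType.Exports.

Local Open Scope classical_set_scope.
Local Open Scope complex_scope.
Local Open Scope ring_scope.

(** * Real inner product *)

Section InnerProduct.
Set Implicit Arguments.
Unset Strict Implicit.
Context {R : realType} {H : hilbertType R}.
Implicit Types (x y z : H) (T S : H -> H).

(** Estimates are made with [ip], the real part of [dot], so that they become real polynomial
    inequalities for [lra] and [nra]; [phase] and [ip_dot] lead back to complex values. The mixed
    Schwarz inequality is obtained variationally, without polar decomposition or spectral theorem,
    and square roots are limits of an explicit iteration. In the first bound, the estimate of
    [4 |<Tx,x>|^2] contributes [alpha / 4] to both squares and [|Tx|^2 = <P^2 x,x>] contributes
    [1 - alpha]; their sum is [1 - 3 alpha / 4]. Passing to the adjoint exchanges [P] and [Q] but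
    keeps [Re <PQx,x>], which is the real part of [<Qx,Px>] and thus symmetric in the two. *)

Definition ip x y : R := complex.Re (dot x y).

Lemma complex_ReD (a b : R[i]) : complex.Re (a + b) = complex.Re a + complex.Re b.
Proof. by case: a; case: b. Qed.

Lemma complex_ReZ (t : R) (a : R[i]) : complex.Re (t%:C * a) = t * complex.Re a.
Proof. by case: a => a b /=; rewrite mul0r subr0. Qed.

Lemma dotC x y : dot x y = (dot y x)^*.
Proof. by rewrite hermC expr0 mul1r. Qed.

Lemma dotDl x y z : dot (x + y) z = dot x z + dot y z.
Proof. exact: linearDl. Qed.

Lemma dotDr x y z : dot x (y + z) = dot x y + dot x z.
Proof. exact: linearDr. Qed.

Lemma dotZl (a : R[i]) x y : dot (a *: x) y = a * dot x y.
Proof. by rewrite linearZl_LR. Qed.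

Lemma dotZr (a : R[i]) x y : dot x (a *: y) = a^* * dot x y.
Proof. by rewrite linearZr_LR. Qed.

Lemma ipC x y : ip x y = ip y x.
Proof. by rewrite /ip dotC; case: (dot y x). Qed.

Lemma ipDl x y z : ip (x + y) z = ip x z + ip y z.
Proof. by rewrite /ip dotDl complex_ReD. Qed.

Lemma ipDr x y z : ip x (y + z) = ip x y + ip x z.
Proof. by rewrite /ip dotDr complex_ReD. Qed.

Lemma ipZl (t : R) x y : ip (t%:C *: x) y = t * ip x y.
Proof. by rewrite /ip dotZl complex_ReZ. Qed.

Lemma ipZr (t : R) x y : ip x (t%:C *: y) = t * ip x y.
Proof. by rewrite ipC ipZl ipC. Qed.

Lemma ipNl x y : ip (- x) y = - ip x y.
Proof. by rewrite -scaleN1r -(rmorph1 (real_complex R)) -rmorphN ipZl mulN1r. Qed.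

Lemma ipNr x y : ip x (- y) = - ip x y.
Proof. by rewrite ipC ipNl ipC. Qed.

Lemma ip0l y : ip 0 y = 0.
Proof. by rewrite -(subrr y) ipDl ipNl subrr. Qed.

Lemma ip0r y : ip y 0 = 0.
Proof. by rewrite ipC ip0l. Qed.

Definition ipE := (ipDl, ipDr, ipNl, ipNr, ipZl, ipZr).

Lemma norm_rnorm (V : normedZmodType R[i]) (x : V) : `|x| = (rnorm x)%:C.
Proof. by rewrite /rnorm RRe_real // normr_real. Qed.

Lemma rnorm_ge0 (V : normedZmodType R[i]) (x : V) : 0 <= rnorm x.
Proof. by rewrite -ler0c -norm_rnorm. Qed.

Lemma rnormD (V : normedZmodType R[i]) (x y : V) :
  rnorm (x + y) <= rnorm x + rnorm y.
Proof. by rewrite -lecR rmorphD /= -!norm_rnorm ler_normD. Qed.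

Lemma rnormN (V : normedZmodType R[i]) (x : V) : rnorm (- x) = rnorm x.
Proof. by rewrite /rnorm normrN. Qed.

Lemma rnormB (V : normedZmodType R[i]) (x y : V) : rnorm (x - y) = rnorm (y - x).
Proof. by rewrite -rnormN opprB. Qed.

Lemma rnorm0 (V : normedZmodType R[i]) : rnorm (0 : V) = 0.
Proof. by rewrite /rnorm normr0. Qed.

Lemma rnorm0_eq0 (V : normedZmodType R[i]) (x : V) : rnorm x = 0 -> x = 0.
Proof. by move=> x0; apply/eqP; rewrite -normr_eq0 norm_rnorm x0. Qed.

Lemma dotxx x : dot x x = (rnorm x ^+ 2)%:C.
Proof. by rewrite dot_norm norm_rnorm rmorphXn. Qed.

Lemma ipxx x : ip x x = rnorm x ^+ 2.
Proof. by rewrite /ip dotxx. Qed.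

Lemma ip_ge0 x : 0 <= ip x x.
Proof. by rewrite ipxx exprn_ge0 ?rnorm_ge0. Qed.

Lemma ipxx_eq0 x : ip x x = 0 -> x = 0.
Proof. by rewrite ipxx => /eqP; rewrite expf_eq0 /= => /eqP /rnorm0_eq0. Qed.

(** Testing against all [z] turns vector identities into scalar ones, which [ring], [field] or [lra]
    can settle. *)
Lemma ip_eq x y : (forall z, ip z x = ip z y) -> x = y.
Proof.
move=> xy; apply/eqP; rewrite -subr_eq0; apply/eqP/ipxx_eq0.
by rewrite ipDr ipNr xy subrr.
Qed.

Lemma rnormE x : rnorm x = Num.sqrt (ip x x).
Proof. by rewrite ipxx sqrtr_sqr ger0_norm ?rnorm_ge0. Qed.

Lemma rnormZ (V : normedModType R[i]) (a : R[i]) (x : V) :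
  rnorm (a *: x) = rnorm a * rnorm x.
Proof.
apply: (@complexI R); rewrite rmorphM /= -!norm_rnorm; exact: normrZ.
Qed.

Lemma rnormC (t : R) : rnorm t%:C = `|t|.
Proof. by rewrite /rnorm normc_def /= expr0n addr0 sqrtr_sqr. Qed.

Lemma rnormM (a b : R[i]) : rnorm (a * b) = rnorm a * rnorm b.
Proof. by apply: (@complexI R); rewrite rmorphM /= -!norm_rnorm normrM. Qed.

Lemma rnorm_conj (a : R[i]) : rnorm a^* = rnorm a.
Proof. by rewrite /rnorm norm_conjC. Qed.

Lemma rnormX2 (a : R[i]) : a * a^* = (rnorm a ^+ 2)%:C.
Proof. by rewrite -normCK norm_rnorm rmorphXn. Qed.

Lemma cauchy_schwarz x y : ip x y <= rnorm x * rnorm y.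
Proof.
have [x0|x0] := eqVneq (rnorm x) 0.
  by rewrite (rnorm0_eq0 x0) ip0l rnorm0 mul0r.
have [y0|y0] := eqVneq (rnorm y) 0.
  by rewrite (rnorm0_eq0 y0) ip0r rnorm0 mulr0.
have xp : 0 < rnorm x by rewrite lt_def x0 rnorm_ge0.
have yp : 0 < rnorm y by rewrite lt_def y0 rnorm_ge0.
have := ip_ge0 ((rnorm y)%:C *: x - (rnorm x)%:C *: y).
rewrite !ipE (ipC y x) !ipxx => h.
have xy : 0 < rnorm x * rnorm y by rewrite mulr_gt0.
rewrite -(ler_pM2l xy); nra.
Qed.

Lemma phase (a : R[i]) : exists2 u : R[i], rnorm u = 1 & u * a = (rnorm a)%:C.
Proof.
have [->|a0] := eqVneq a 0.
  by exists 1; [rewrite /rnorm normr1 | rewrite mulr0 rnorm0].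
have na : rnorm a != 0 by apply: contra_neq a0; exact: rnorm0_eq0.
exists ((rnorm a)^-1%:C * a^*).
  by rewrite rnormM rnorm_conj rnormC ger0_norm ?invr_ge0 ?rnorm_ge0 // mulVf.
by rewrite -mulrA (mulrC a^*) rnormX2 -rmorphM /= expr2 mulKf.
Qed.

Lemma cauchy_schwarz_dot x y : rnorm (dot x y) <= rnorm x * rnorm y.
Proof.
have [u u1 ua] := phase (dot x y).
have := cauchy_schwarz (u *: x) y.
by rewrite /ip dotZl ua rnormZ u1 mul1r.
Qed.

Lemma ip_i x y : ip x (- 'i *: y) = - complex.Im (dot x y).
Proof.
rewrite /ip dotZr; case: (dot x y) => a b /=.
by rewrite ?(oppr0, mul0r, opprK, mul1r, sub0r).
Qed.

(** The scalar [1] recovers the real part of [dot], the scalar [- 'i] its imaginary part. *)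
Lemma ip_dot x y x' y' :
  (forall c : R[i], ip x (c *: y) = ip x' (c *: y')) -> dot x y = dot x' y'.
Proof.
move=> h; apply/eqP; rewrite eq_complex; apply/andP; split; apply/eqP.
  by have := h 1; rewrite !scale1r.
by apply: oppr_inj; rewrite -!ip_i h.
Qed.

End InnerProduct.

(** * Riesz representation and adjoints *)

Section Adjoint.
Set Implicit Arguments.
Unset Strict Implicit.
Context {R : realType} {H : hilbertType R}.
Implicit Types (x y z : H) (T S : H -> H).

Lemma linear_mapD T x y : linear T -> T (x + y) = T x + T y.
Proof. by move=> hT; have := hT 1 x y; rewrite !scale1r. Qed.

Lemma linear_map0 T : linear T -> T 0 = 0.
Proof. by move=> hT; apply: (addrI (T 0)); rewrite -linear_mapD // !addr0. Qed.

Lemma linear_mapZ T a x : linear T -> T (a *: x) = a *: T x.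
Proof. by move=> hT; have := hT a x 0; rewrite !addr0 linear_map0 // addr0. Qed.

Lemma linear_mapN T x : linear T -> T (- x) = - T x.
Proof. by move=> hT; rewrite -scaleN1r linear_mapZ // scaleN1r. Qed.

Lemma bounded_operatorP T : bounded_operator T ->
  linear T /\ exists2 M : R, 0 < M & forall x, rnorm (T x) <= M * rnorm x.
Proof.
case=> lT [M hM]; split=> //; exists (`|M| + 1); first by rewrite ltr_wpDl.
move=> x; apply: (le_trans (hM x)); apply: ler_wpM2r; first exact: rnorm_ge0.
by rewrite (le_trans (ler_norm M)) // lerDl.
Qed.

(** Completeness with an explicit rate: since the rate survives in the limit, properties of the
    limit can be proved by letting an error term tend to 0. *)
Lemma cauchy_rate_cvg (u : nat -> H) (c : nat -> R) :
  (forall e, 0 < e -> exists n, c n < e) ->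
  (forall n m, (n <= m)%N -> rnorm (u m - u n) <= c n) ->
  exists l, forall n, rnorm (u n - l) <= c n.
Proof.
move=> c0 uc.
have near_u (e : R[i]) : 0 < e -> exists N, forall m n, (N <= m)%N -> (N <= n)%N ->
    `|u m - u n| < e.
  rewrite ltcE => /andP[/eqP /= eI eR].
  have -> : e = (complex.Re e)%:C.
    by apply/eqP; rewrite eq_complex /= eqxx eI eqxx.
  have [N cN] := c0 _ (divr_gt0 eR (ltr0n _ 2)); exists N => m n Nm Nn.
  rewrite norm_rnorm ltcR.
  have -> : u m - u n = (u m - u N) + (u N - u n) by rewrite addrA subrK.
  rewrite (le_lt_trans (rnormD _ _)) // (splitr (complex.Re e)).
  apply: ltrD; last rewrite rnormB; apply: le_lt_trans cN; exact: uc.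
have /cauchy_cvgP : cauchy (u @ \oo).
  apply/cauchy_ballP => e e0; have [N hN] := near_u e e0.
  exists (u @` [set n | (N <= n)%N], u @` [set n | (N <= n)%N]).
    by split; exists N => // n Nn; exists n.
  case=> _ _ [/= [m Nm <-] [n Nn <-]]; rewrite -ball_normE /=; exact: hN.
move=> /cvg_ex[l /= ul]; exists l => n.
apply/ler_addgt0Pr => e e0.
have e0' : 0 < e%:C :> R[i] by rewrite ltcR.
have /cvgrPdist_lt /(_ _ e0')[N _ hN] := ul.
have := hN (maxn N n) (leq_maxl _ _).
rewrite norm_rnorm /= ltcR => /ltW h.
have -> : u n - l = (u n - u (maxn N n)) + (u (maxn N n) - l) by rewrite addrA subrK.
rewrite (le_trans (rnormD _ _)) // lerD //; last by rewrite rnormB.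
by rewrite rnormB uc // leq_maxr.
Qed.

Lemma expr_half_small (e : R) : 0 < e -> exists n, (2^-1 : R) ^+ n < e.
Proof.
move=> e0.
have /cvgrPdist_lt /(_ _ e0)[N _ hN] : (fun n => (2^-1 : R) ^+ n) @ \oo --> (0 : R).
  by apply: cvg_expr; rewrite ger0_norm ?invr_ge0 // invf_lt1 // ltr1n.
exists N; have := hN N (leqnn N).
by rewrite sub0r normrN ger0_norm // exprn_ge0 // invr_ge0.
Qed.

(* The representing vector minimises [ip x x - 2 * f x]; minimising sequences
   are Cauchy by the parallelogram identity. *)
Lemma riesz (f : H -> R) (M : R) :
  (forall x y, f (x + y) = f x + f y) ->
  (forall (t : R) x, f (t%:C *: x) = t * f x) ->
  (forall x, f x <= M * rnorm x) -> exists z, forall x, f x = ip x z.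
Proof.
move=> fD fZ fM.
have fN x : f (- x) = - f x.
  by rewrite -scaleN1r -(rmorph1 (real_complex R)) -rmorphN fZ mulN1r.
pose phi x := ip x x - 2 * f x.
have phi_lb x : - M ^+ 2 <= phi x.
  rewrite /phi ipxx; have := fM x; have := sqr_ge0 (rnorm x - M); nra.
pose d := inf (range phi).
have hi : has_inf (range phi).
  split; first by exists (phi 0); exists 0.
  by exists (- M ^+ 2) => _ [x _ <-].
have d_le x : d <= phi x by apply: ge_inf; [case: hi | exists x].
(* The tolerance is squared so that the parallelogram identity, with [phi >= d] at the midpoint of
   [u n] and [u m], bounds their distance by [2 * 2^-1 ^+ n]. *)
have /choice[u hu] n : exists x, phi x < d + (2^-1 ^+ n) ^+ 2.
  have e0 : 0 < ((2^-1 : R) ^+ n) ^+ 2 by rewrite !exprn_gt0 // invr_gt0.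
  by have [_ [x _ <-] hx] := inf_adherent e0 hi; exists x.
have half0 n : 0 <= (2^-1 : R) ^+ n by rewrite exprn_ge0 // invr_ge0.
have [z hz] : exists z, forall n, rnorm (u n - z) <= 2 * 2^-1 ^+ n.
  apply: cauchy_rate_cvg => [e e0|n m nm].
    have [n hn] := expr_half_small (divr_gt0 e0 (ltr0n _ 2)).
    by exists n; rewrite mulrC -ltr_pdivlMr.
  have := d_le (2^-1%:C *: (u n + u m)).
  have := hu n; have := hu m; rewrite /phi fZ fD !ipE (ipC (u m) (u n)) => h1 h2 h3.
  have mn : (2^-1 : R) ^+ m <= 2^-1 ^+ n.
    by apply: ler_wiXn2l => //; rewrite ?invr_ge0 // invf_le1 // ler1n.
  have h4 : (2^-1 : R) ^+ m ^+ 2 <= (2^-1 ^+ n) ^+ 2 by rewrite lerXn2r // nnegrE.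
  rewrite -(@ler_pXn2r _ 2) // ?nnegrE ?rnorm_ge0 ?mulr_ge0 //.
  rewrite -ipxx !ipE (ipC (u m) (u n)) exprMn; lra.
exists z.
suff le_f w : f w <= ip w z.
  move=> w; apply/eqP; rewrite eq_le le_f /=.
  by have := le_f (- w); rewrite fN ipNl lerN2.
rewrite leNgt; apply/negP => e0.
pose e := f w - ip w z; have {}e0 : 0 < e by rewrite subr_gt0.
pose W := rnorm w; have W0 : 0 <= W by exact: rnorm_ge0.
have W1 : 0 < W ^+ 2 + 1 by rewrite ltr_wpDl // sqr_ge0.
(* Moving [u n] by [t] along [w] should lower [phi] by [2 t e - t^2 W^2 >= t e]. With
   [c = 2^-1 ^+ n], the error made by using [u n] in place of [z] is at most [c * (4 t W + 1)]; [n]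
   is chosen to make it smaller than [t e]. *)
pose t := e / (W ^+ 2 + 1); have t0 : 0 < t by rewrite divr_gt0.
have tW : t * W ^+ 2 <= e.
  by rewrite /t -mulrA ler_piMr ?(ltW e0) // mulrC ler_pdivrMr // mul1r lerDl.
have k0 : 0 < 4 * t * W + 1.
  by have := mulr_ge0 (ltW t0) W0; lra.
have [n hn] := expr_half_small (divr_gt0 (mulr_gt0 t0 e0) k0).
have c1 : (2^-1 : R) ^+ n <= 1.
  by rewrite exprn_ile1 // ?invr_ge0 // invf_le1 // ler1n.
have c0 := half0 n; have := hz n; have := hu n; move: hn c1 c0.
set c := 2^-1 ^+ n; rewrite ltr_pdivlMr // => hn c1 c0 hun hzn.
have := le_trans (cauchy_schwarz w (u n - z)) (ler_wpM2l W0 hzn).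
have := d_le (u n + t%:C *: w); move: hun.
rewrite /phi fD fZ !ipE (ipC (u n) w) (ipxx w) -/W => h1 h2 h3.
have h4 := ler_wpM2l (ltW t0) h3; have h5 := ler_wpM2l (ltW t0) tW.
have h6 := ler_wpM2l c0 c1.
rewrite /e in h5 hn; nra.
Qed.

(** Riesz is applied to the real functional [ip (T x) y] of [x]. Complex linearity of [T] then gives
    that of [S], by moving scalars across [ip], and upgrades the identity from [ip] to [dot]. *)
Lemma adjoint_exists T : bounded_operator T ->
  exists S, bounded_operator S /\ forall x y, dot (T x) y = dot x (S y).
Proof.
move=> /bounded_operatorP[lT [M M0 hM]].
have /choice[S hS] y : exists z, forall x, ip (T x) y = ip x z.
  apply: (@riesz _ (M * rnorm y)) => [x z|t x|x].
  - by rewrite linear_mapD // ipDl.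
  - by rewrite linear_mapZ // ipZl.
  - rewrite mulrAC (le_trans (cauchy_schwarz _ _)) // ler_wpM2r ?rnorm_ge0 //.
have ipZ (a : R[i]) x y : ip x (a *: y) = ip (a^* *: x) y.
  by rewrite /ip dotZl dotZr.
have lS : linear S.
  move=> a x y; apply: ip_eq => z.
  by rewrite -hS !ipDr ipZ -(linear_mapZ _ _ lT) !hS -ipZ.
exists S; split.
  split=> //; exists M => y.
  have [Sy0|Sy0] := eqVneq (rnorm (S y)) 0; first by rewrite Sy0 mulr_ge0 ?rnorm_ge0 ?ltW.
  have Sy : 0 < rnorm (S y) by rewrite lt_def Sy0 rnorm_ge0.
  rewrite -(ler_pM2l Sy) -expr2 -ipxx -hS (le_trans (cauchy_schwarz _ _)) //.
  by rewrite mulrA ler_wpM2r ?rnorm_ge0 // mulrC.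
by move=> x y; apply: ip_dot => c; rewrite hS linear_mapZ.
Qed.

Lemma adjointP T : bounded_operator T ->
  bounded_operator (adjoint T) /\ forall x y, dot (T x) y = dot x (adjoint T y).
Proof. by move=> /adjoint_exists; exact: xgetPex. Qed.

Lemma ip_adjoint T x y : bounded_operator T -> ip (T x) y = ip x (adjoint T y).
Proof. by move=> /adjointP[_ h]; rewrite /ip h. Qed.

(** * Bounded, self-adjoint and positive operators *)

Lemma bounded_operator_comp T S :
  bounded_operator T -> bounded_operator S -> bounded_operator (T \o S).
Proof.
move=> /bounded_operatorP[lT [M M0 hM]] /bounded_operatorP[lS [N N0 hN]].
split=> [a x y /=|]; first by rewrite lS lT.
exists (M * N) => x /=; apply: (le_trans (hM _)); rewrite -mulrA.
by apply: ler_wpM2l (hN x); exact: ltW.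
Qed.

Lemma bounded_operatorD T S :
  bounded_operator T -> bounded_operator S -> bounded_operator (T + S).
Proof.
move=> [lT [M hM]] [lS [N hN]].
split=> [a x y|]; first by rewrite addrfctE lT lS scalerDr addrACA.
by exists (M + N) => x; rewrite addrfctE (le_trans (rnormD _ _)) // mulrDl lerD.
Qed.

Lemma bounded_operatorZ (c : R[i]) T :
  bounded_operator T -> bounded_operator (c *: T).
Proof.
move=> [lT [M hM]]; split=> [a x y|].
  by rewrite scalrfctE lT scalerDr !scalerA mulrC.
exists (rnorm c * M) => x.
by rewrite scalrfctE rnormZ -mulrA ler_wpM2l ?rnorm_ge0.
Qed.

(* Polarization: [dot (T z) z] is real at [z = x + 'i *: y]. *)
Lemma positive_selfadjoint T x y : positive_operator T -> ip (T x) y = ip x (T y).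
Proof.
move=> [[lT _] pT].
have real z : complex.Im (dot (T z) z) = 0 by apply: ger0_Im.
have := real (x + 'i *: y); have := real x; have := real y.
rewrite linear_mapD // linear_mapZ // !(dotDl, dotDr, dotZl, dotZr).
rewrite (ipC x) /ip.
case: (dot (T x) x) (dot (T y) y) (dot (T x) y) (dot (T y) x).
by move=> a1 b1 [a2 b2] [a3 b3] [a4 b4] /=; lra.
Qed.

Lemma ip_positive_ge0 T x : positive_operator T -> 0 <= ip (T x) x.
Proof. by case=> _ /(_ x); rewrite lecE => /andP[]. Qed.

(** Symmetry for [ip] extends to [dot] by complex linearity, and this makes [dot (T x) x] real. *)
Lemma positive_operatorI T : bounded_operator T ->
  (forall x y, ip (T x) y = ip x (T y)) -> (forall x, 0 <= ip (T x) x) ->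
  positive_operator T.
Proof.
move=> hT saT pT; split=> // x; rewrite lecE /= (pT x) andbT eq_sym.
have : dot (T x) x = dot x (T x).
  by apply: ip_dot => c; rewrite saT linear_mapZ //; case: hT.
rewrite (dotC x); case: (dot (T x) x) => a b [] /= hb; apply/eqP; lra.
Qed.

End Adjoint.

(** * Square roots of positive operators *)

Section SquareRoot.
Set Implicit Arguments.
Unset Strict Implicit.
Context {R : realType} {H : hilbertType R}.
Implicit Types (x y z : H) (X Y : H -> H) (n : nat).

(* [1 - gap n] is the value at 1 of the iteration [y := (1 + y ^+ 2) / 2]. *)
Fixpoint gap n : R := if n is m.+1 then gap m - gap m ^+ 2 / 2 else 1.

Lemma gap_bounds n : 0 <= gap n <= 2 / n.+2%:R.
Proof.
elim: n => [|n /andP[g0 gn]] /=; first by rewrite divff // ler01 lexx.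
have n2 : 2 <= n.+2%:R :> R by rewrite ler_nat.
have n20 : 0 < n.+2%:R :> R by rewrite ltr0n.
have g1 : gap n <= 1 by rewrite (le_trans gn) // ler_pdivrMr // mul1r.
have -> : n.+3%:R = n.+2%:R + 1 :> R by rewrite -natr1.
move: gn n2 n20; set k : R := n.+2%:R => gn n2 n20.
apply/andP; split; first by nra.
have k1 : 0 < k + 1 by lra.
rewrite ler_pdivlMr //; move: gn; rewrite ler_pdivlMr // => gn.
set q := 2 / k; have qk : q * k = 2 by rewrite mulfVK // gt_eqF.
have q1 : q <= 1 by rewrite /q ler_pdivrMr // mul1r.
have q0 : 0 < q by rewrite divr_gt0.
have gq : gap n <= q by rewrite /q ler_pdivlMr.
(* The map [t - t^2 / 2] increases on [0, 1], so [gap n] may be replaced by its bound [q]; since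
   [q * k = 2], the product below is [2 - q^2 / 2]. *)
have step : gap n - gap n ^+ 2 / 2 <= q - q ^+ 2 / 2 by nra.
apply: (le_trans (ler_wpM2r (ltW k1) step)).
have -> : (q - q ^+ 2 / 2) * (k + 1) = (q * k) + q - q * (q * k) / 2 - q ^+ 2 / 2.
  by field.
rewrite qk; nra.
Qed.

Lemma gap_ge0 n : 0 <= gap n. Proof. by case/andP: (gap_bounds n). Qed.

Lemma gap_decr n m : (n <= m)%N -> gap m <= gap n.
Proof.
elim: m => [|m IH]; first by rewrite leqn0 => /eqP->.
rewrite leq_eqVlt => /predU1P[->//|/IH]; apply: le_trans => /=.
by rewrite gerBl divr_ge0 // sqr_ge0.
Qed.

Lemma gap_small (e : R) : 0 < e -> exists n, gap n < e.
Proof.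
move=> e0; have := archi_boundP (divr_ge0 (ler0n R 2) (ltW e0)).
set n := Num.bound _ => hn; exists n.
have /andP[_ gn] := gap_bounds n; apply: (le_lt_trans gn).
rewrite ltr_pdivrMr ?ltr0n // mulrC -ltr_pdivrMr // (lt_le_trans hn) //.
by rewrite ler_nat -addn2 leq_addr.
Qed.

Lemma le0_gap (r C : R) : 0 <= C -> (forall n, r <= gap n * C) -> r <= 0.
Proof.
move=> C0 h; apply/ler_addgt0Pr => e e0; rewrite add0r.
have C1 : 0 < C + 1 by rewrite ltr_wpDl.
have [n gn] := gap_small (divr_gt0 e0 C1).
rewrite (le_trans (h n)) // (@le_trans _ _ (gap n * (C + 1))) //.
  by rewrite ler_wpM2l ?gap_ge0 // lerDl.
by rewrite -ler_pdivlMr // ltW.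
Qed.

Lemma eq_gap x y (C : R) :
  0 <= C -> (forall n, rnorm (x - y) <= gap n * C) -> x = y.
Proof.
move=> C0 h; apply/eqP; rewrite -subr_eq0; apply/eqP/rnorm0_eq0.
by apply/eqP; rewrite eq_le (le0_gap C0 h) rnorm_ge0.
Qed.

Definition half_sum x y : H := (2^-1)%:C *: (x + y).

(* The limit [Z] satisfies [2 Z = X + Z ^ 2], hence [(1 - Z) ^ 2 = 1 - X]. *)
Fixpoint sqrt_iter X n : H -> H :=
  if n is m.+1 then fun x => half_sum (X x) (sqrt_iter X m (sqrt_iter X m x))
  else fun=> 0.

Lemma rnorm_half_sum x y : rnorm (half_sum x y) = rnorm (x + y) / 2.
Proof. by rewrite rnormZ rnormC ger0_norm ?invr_ge0 // mulrC. Qed.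

Lemma half_sumB x y y' : half_sum x y - half_sum x y' = half_sum y (- y').
Proof. by rewrite /half_sum -scalerBr opprD addrACA subrr add0r. Qed.

Section Iteration.
Variable X : H -> H.
Hypothesis lX : linear X.
Hypothesis X1 : forall x, rnorm (X x) <= rnorm x.
Local Notation Y := (sqrt_iter X).

Lemma sqrt_iter_linear n : linear (Y n).
Proof.
elim: n => [|n IH] a x y /=; first by rewrite scaler0 addr0.
rewrite /half_sum lX !IH scalerA mulrC -scalerA -scalerDr; congr (_ *: _).
by rewrite scalerDr addrACA.
Qed.

(** The scalar iteration started from [X = 1] majorizes the operator iteration: its values
    [1 - gap n] bound the norms, and its increments bound the steps in [sqrt_iter_step]. *)
Lemma sqrt_iter_bound n x : rnorm (Y n x) <= (1 - gap n) * rnorm x.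
Proof.
elim: n x => [|n IH] x /=; first by rewrite rnorm0 subrr mul0r.
have g1 : 0 <= 1 - gap n by rewrite subr_ge0 (gap_decr (leq0n n)).
have h1 := le_trans (IH (Y n x)) (ler_wpM2l g1 (IH x)).
rewrite rnorm_half_sum; have h2 := rnormD (X x) (Y n (Y n x)).
have := X1 x; lra.
Qed.

Lemma sqrt_iter_step n x :
  rnorm (Y n.+1 x - Y n x) <= (gap n - gap n.+1) * rnorm x.
Proof.
elim: n x => [|n IH] x.
  rewrite /= subr0 rnorm_half_sum addr0; have := X1 x; lra.
have -> : Y n.+2 x - Y n.+1 x = half_sum (Y n.+1 (Y n.+1 x)) (- Y n (Y n x)).
  exact: half_sumB.
rewrite rnorm_half_sum.
(* The factorization [A^2 - B^2 = A (A - B) + (A - B) B] uses no commutation; the scalar increments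
   factor in the same way. *)
have -> : Y n.+1 (Y n.+1 x) - Y n (Y n x) =
    Y n.+1 (Y n.+1 x - Y n x) + (Y n.+1 (Y n x) - Y n (Y n x)).
  have lY := sqrt_iter_linear n.+1.
  by rewrite (linear_mapD _ _ lY) (linear_mapN _ lY) addrA subrK.
have h := rnormD (Y n.+1 (Y n.+1 x - Y n x)) (Y n.+1 (Y n x) - Y n (Y n x)).
have g1 : 0 <= 1 - gap n.+1 by rewrite subr_ge0 (gap_decr (leq0n n.+1)).
have g2 : 0 <= gap n - gap n.+1 by rewrite subr_ge0 gap_decr.
have h1 := le_trans (sqrt_iter_bound n.+1 _) (ler_wpM2l g1 (IH x)).
have h2 := le_trans (IH _) (ler_wpM2l g2 (sqrt_iter_bound n x)).
have e1 : gap n.+1 = gap n - gap n ^+ 2 / 2 by [].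
have e2 : gap n.+2 = gap n.+1 - gap n.+1 ^+ 2 / 2 by [].
have e3 : gap n ^+ 2 = 2 * (gap n - gap n.+1) by rewrite e1; field.
have -> : (gap n.+1 - gap n.+2) * rnorm x =
  ((1 - gap n.+1) * ((gap n - gap n.+1) * rnorm x) +
   (gap n - gap n.+1) * ((1 - gap n) * rnorm x)) / 2.
  rewrite e2.
  have -> : gap n.+1 = gap n - gap n ^+ 2 / 2 by [].
  by field.
lra.
Qed.

Lemma sqrt_iter_cauchy n m x :
  (n <= m)%N -> rnorm (Y m x - Y n x) <= (gap n - gap m) * rnorm x.
Proof.
elim: m => [|m IH]; first by rewrite leqn0 => /eqP->; rewrite !subrr rnorm0 mul0r.
rewrite leq_eqVlt => /predU1P[->|/IH{}IH]; first by rewrite !subrr rnorm0 mul0r.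
have -> : Y m.+1 x - Y n x = (Y m.+1 x - Y m x) + (Y m x - Y n x).
  by rewrite addrA subrK.
rewrite (le_trans (rnormD _ _)) //; have := sqrt_iter_step m x; lra.
Qed.

Lemma sqrt_iter_selfadjoint n x y :
  (forall x y, ip (X x) y = ip x (X y)) -> ip (Y n x) y = ip x (Y n y).
Proof.
move=> saX; elim: n x y => [|n IH] x y /=; first by rewrite ip0l ip0r.
by rewrite /half_sum ipZl ipZr ipDl ipDr saX !IH.
Qed.

(** Each property of [Z] is inherited from [sqrt_iter X n] up to an error of [gap n] times a
    constant, which [eq_gap] and [le0_gap] remove. *)
Lemma quadratic_fixpoint : (forall x y, ip (X x) y = ip x (X y)) ->
  exists Z : H -> H, [/\ linear Z, forall x, rnorm (Z x) <= rnorm x,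
    forall x y, ip (Z x) y = ip x (Z y) &
    forall x, Z x + Z x = X x + Z (Z x)].
Proof.
move=> saX.
have /choice[Z hZ] x : exists z, forall n, rnorm (Y n x - z) <= gap n * rnorm x.
  apply: cauchy_rate_cvg => [e e0|n m nm].
    have x1 : 0 < rnorm x + 1 by rewrite ltr_wpDl ?rnorm_ge0.
    have [n gn] := gap_small (divr_gt0 e0 x1); exists n.
    rewrite (@le_lt_trans _ _ (gap n * (rnorm x + 1))) //.
      by rewrite ler_wpM2l ?gap_ge0 // lerDl.
    by rewrite -ltr_pdivlMr.
  rewrite (le_trans (sqrt_iter_cauchy x nm)) // ler_wpM2r ?rnorm_ge0 //.
  by rewrite gerBl gap_ge0.
have Z1 x : rnorm (Z x) <= rnorm x.
  by have := hZ x 0%N; rewrite /= mul1r sub0r rnormN.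
have lZ : linear Z.
  move=> a x y.
  apply: (@eq_gap _ _ (rnorm (a *: x + y) + (rnorm a * rnorm x + rnorm y))).
    by rewrite !addr_ge0 ?mulr_ge0 ?rnorm_ge0.
  move=> n.
  have -> : Z (a *: x + y) - (a *: Z x + Z y) =
      - (Y n (a *: x + y) - Z (a *: x + y)) + (a *: (Y n x - Z x) + (Y n y - Z y)).
    rewrite sqrt_iter_linear scalerBr.
    by apply: ip_eq => w; rewrite !ipE; ring.
  have h1 := rnormD (- (Y n (a *: x + y) - Z (a *: x + y)))
                    (a *: (Y n x - Z x) + (Y n y - Z y)).
  have h2 := rnormD (a *: (Y n x - Z x)) (Y n y - Z y).
  have h3 := ler_wpM2l (rnorm_ge0 a) (hZ x n).
  rewrite rnormN in h1; rewrite rnormZ in h2.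
  have := hZ y n; have := hZ (a *: x + y) n; lra.
have saZ x y : ip (Z x) y <= ip x (Z y).
  rewrite -subr_le0; apply: (@le0_gap _ (2 * (rnorm x * rnorm y))).
    by rewrite !mulr_ge0 ?rnorm_ge0.
  move=> n.
  have h1 := cauchy_schwarz (- (Y n x - Z x)) y.
  have h2 := cauchy_schwarz x (Y n y - Z y).
  have h3 := ler_wpM2r (rnorm_ge0 y) (hZ x n).
  have h4 := ler_wpM2l (rnorm_ge0 x) (hZ y n).
  rewrite rnormN in h1.
  have := sqrt_iter_selfadjoint n x y saX.
  move: h1 h2; rewrite !ipE; lra.
exists Z; split=> // [x y|x].
  by apply/eqP; rewrite eq_le saZ (ipC x) (ipC _ y) saZ.
apply: (@eq_gap _ _ (4 * rnorm x)); first by rewrite mulr_ge0 ?rnorm_ge0.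
move=> n.
(* Substitute [2 Y (n+1) = X + Y n ^ 2]; the four differences on the right have norm at most
   [gap n * rnorm x] each. *)
have -> : Z x + Z x - (X x + Z (Z x)) =
    (- (Y n.+1 x - Z x) - (Y n.+1 x - Z x)) +
    ((Y n (Z x) - Z (Z x)) + Y n (Y n x - Z x)).
  rewrite (linear_mapD _ _ (sqrt_iter_linear n)) (linear_mapN _ (sqrt_iter_linear n)).
  by apply: ip_eq => w; rewrite /= /half_sum !ipE; field.
have h1 := rnormD (- (Y n.+1 x - Z x) - (Y n.+1 x - Z x))
    ((Y n (Z x) - Z (Z x)) + Y n (Y n x - Z x)).
have h2 := rnormD (- (Y n.+1 x - Z x)) (- (Y n.+1 x - Z x)).
have h3 := rnormD (Y n (Z x) - Z (Z x)) (Y n (Y n x - Z x)).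
rewrite rnormN in h2.
have h4 := le_trans (hZ (Z x) n) (ler_wpM2l (gap_ge0 n) (Z1 x)).
have g1 : 1 - gap n <= 1 by rewrite gerBl gap_ge0.
have h5 := le_trans (sqrt_iter_bound n (Y n x - Z x))
  (ler_wpM2r (rnorm_ge0 _) g1).
have h6 := ler_wpM2r (rnorm_ge0 x) (gap_decr (leqnSn n)).
have := hZ x n; have := hZ x n.+1; lra.
Qed.

End Iteration.

(** With [K] a bound for [A], the operator [X = 1 - A / K] lies between 0 and 1, and
    [S = sqrt K (1 - Z)] has square [K (1 - X) = A]. *)
Lemma sqrt_exists A : positive_operator A ->
  exists S : H -> H, positive_operator S /\ S \o S = A.
Proof.
move=> pA; have [[lA _] _] := pA.
have [_ [K K0 AK]] := bounded_operatorP pA.1.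
pose X x := x - (K^-1)%:C *: A x.
have lX : linear X.
  move=> a x y; rewrite /X lA !scalerDr scalerN !scalerA (mulrC a).
  by rewrite opprD addrACA.
have saX x y : ip (X x) y = ip x (X y).
  by rewrite /X !ipE (positive_selfadjoint _ _ pA).
have ipX x : ip (X x) x = ip x x - K^-1 * ip (A x) x by rewrite /X !ipE.
have AX x : K%:C *: (x - X x) = A x.
  rewrite /X opprB addrC subrK scalerA -rmorphM /= divff ?gt_eqF //.
  by rewrite scale1r.
clearbody X.
have X_ge0 x : 0 <= ip (X x) x.
  rewrite ipX subr_ge0 mulrC ler_pdivrMr // ipxx.
  rewrite (le_trans (cauchy_schwarz _ _)) // expr2 mulrAC -mulrA.
  by rewrite (le_trans (ler_wpM2r (rnorm_ge0 x) (AK x))) // mulrC mulrCA.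
have X_le x : ip (X x) x <= ip x x.
  by rewrite ipX gerBl mulr_ge0 ?invr_ge0 ?(ltW K0) // ip_positive_ge0.
(* Positivity of [X] at [x - X x], with [X <= 1] at [X x], gives [|X x|^2 <= <X x, x>]. *)
have X1 x : rnorm (X x) <= rnorm x.
  rewrite -(@ler_pXn2r _ 2) ?nnegrE ?rnorm_ge0 // -!ipxx.
  have := X_ge0 (x - X x).
  rewrite (linear_mapD _ _ lX) (linear_mapN _ lX) !ipE (saX (X x) x).
  have := X_le (X x); have := X_le x; lra.
have [Z [lZ Z1 saZ fZ]] := quadratic_fixpoint lX X1 saX.
pose s := Num.sqrt K; have s0 : 0 <= s by exact: sqrtr_ge0.
exists (fun x => s%:C *: (x - Z x)); split.
  have bS : bounded_operator (fun x => s%:C *: (x - Z x)).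
    split=> [a x y|].
      rewrite lZ opprD addrACA -scalerBr scalerDr !scalerA.
      by rewrite (mulrC a).
    exists (s * 2) => x; rewrite rnormZ rnormC ger0_norm // -mulrA ler_wpM2l //.
    have := rnormD x (- Z x); rewrite rnormN; have := Z1 x; lra.
  apply: positive_operatorI => // [x y|x].
    by rewrite !ipE saZ.
  rewrite !ipE mulr_ge0 // subr_ge0 (le_trans (cauchy_schwarz _ _)) //.
  by rewrite ipxx expr2 ler_wpM2r ?rnorm_ge0.
apply/funext => x /=.
rewrite (linear_mapZ _ _ lZ) -scalerBr scalerA -rmorphM /= -expr2 sqr_sqrtr ?ltW //.
rewrite (linear_mapD _ _ lZ) (linear_mapN _ lZ).
have -> : x - Z x - (Z x - Z (Z x)) = x - X x.
  by apply: ip_eq => w; have := congr1 (ip w) (fZ x); rewrite !ipE; lra.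
exact: AX.
Qed.

End SquareRoot.

(** * Mixed Schwarz inequality *)

Section MixedSchwarz.
Set Implicit Arguments.
Unset Strict Implicit.
Context {R : realType} {H : hilbertType R}.
Implicit Types x y : H.
Variables T S P Q : H -> H.
Hypothesis bT : bounded_operator T.
Hypothesis TS : forall x y, ip (T x) y = ip x (S y).
Hypothesis pP : positive_operator P.
Hypothesis pQ : positive_operator Q.
Hypothesis PT : forall x, ip (P x) (P x) = ip (T x) (T x).
Hypothesis QS : forall x, ip (Q x) (Q x) = ip (S x) (S x).

Let lT : linear T := bT.1.
Let lP : linear P := pP.1.1.
Let lQ : linear Q := pQ.1.1.

Let sqnorm x y : R := ip x x + ip y y.
(** For [A (x, y) = (S y, T x)] and [B (x, y) = (P x, Q y)] on [H * H], this is the quadratic form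
    of [A - B]. *)
Let gain x y : R := 2 * ip (T x) y - ip (P x) x - ip (Q y) y.

Lemma form_expand (l t : R) x y a b :
  l * sqnorm (x - t%:C *: a) (y - t%:C *: b) - gain (x - t%:C *: a) (y - t%:C *: b) =
  l * sqnorm x y - gain x y
  - 2 * t * (ip (l%:C *: x + P x - S y) a + ip (l%:C *: y + Q y - T x) b)
  + t ^+ 2 * (l * sqnorm a b - gain a b).
Proof.
rewrite /sqnorm /gain !(linear_mapD _ _ lT, linear_mapD _ _ lP, linear_mapD _ _ lQ).
rewrite !(linear_mapN _ lT, linear_mapN _ lP, linear_mapN _ lQ).
rewrite !(linear_mapZ _ _ lT, linear_mapZ _ _ lP, linear_mapZ _ _ lQ) !ipE.
rewrite (positive_selfadjoint a x pP) (positive_selfadjoint b y pQ) (TS a y).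
rewrite (ipC a x) (ipC b y) (ipC a (P x)) (ipC b (Q y)) (ipC (S y) a).
by ring.
Qed.

(** For [z = (x, y)], let [f] be the form of [l + B - A] at [z] and [r = (l + B - A) z], that is,
    [r = (a, b)]. Squaring [(l + B) z = A z + r] and using [|B z| = |A z|] gives
    [l^2 |z|^2 <= 2 <A z, r> + |r|^2]. As [|r|^2 <= K f], a small [f] would force a small [z]. *)
Lemma form_gap (M l : R) : 0 < M -> 0 < l ->
  (forall x, ip (T x) (T x) <= M ^+ 2 * ip x x) ->
  (forall x, ip (S x) (S x) <= M ^+ 2 * ip x x) ->
  (forall x y, - gain x y <= 2 * M * sqnorm x y) ->
  (forall x y, gain x y <= l * sqnorm x y) ->
  exists2 c : R, 0 < c & forall x y, gain x y <= (l - c) * sqnorm x y.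
Proof.
move=> M0 l0 hT hS gainK gain_l.
(* The weight in Young's inequality for [2 <A z, r>]: the part [d |A z|^2] is then at most half of
   [l^2 |z|^2]. *)
pose d := l ^+ 2 / (2 * M ^+ 2).
have d0 : 0 < d by rewrite divr_gt0 ?mulr_gt0 ?exprn_gt0.
have dM : d * M ^+ 2 = l ^+ 2 / 2 by rewrite /d; field; rewrite gt_eqF.
pose K := l + 2 * M; have K0 : 0 < K by rewrite addr_gt0 ?mulr_gt0.
have k0 : 0 < (1 + d^-1) * K by rewrite mulr_gt0 // addr_gt0 ?invr_gt0.
exists (l ^+ 2 / 2 / ((1 + d^-1) * K)).
  by rewrite divr_gt0 // divr_gt0 ?exprn_gt0.
move=> x y.
set a := l%:C *: x + P x - S y; set b := l%:C *: y + Q y - T x.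
set f := l * sqnorm x y - gain x y.
(* One gradient step of length [1 / K]: the form of [l + B - A] stays nonnegative there, and its
   second-order coefficient is at most [K]. *)
have abK : sqnorm a b <= K * f.
  have := gain_l (x - K^-1%:C *: a) (y - K^-1%:C *: b).
  rewrite -subr_ge0 form_expand -/a -/b -/f -/(sqnorm a b).
  have /(ler_wpM2l (sqr_ge0 K^-1)) : l * sqnorm a b - gain a b <= K * sqnorm a b.
    by have := gainK a b; rewrite /K; lra.
  have -> : K^-1 ^+ 2 * (K * sqnorm a b) = K^-1 * sqnorm a b.
    by field; rewrite gt_eqF.
  move=> h1 h2; have : K^-1 * sqnorm a b <= f by lra.
  by rewrite mulrC ler_pdivrMr // mulrC.
have eP : l%:C *: x + P x = S y + a by rewrite /a [RHS]addrC subrK.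
have eQ : l%:C *: y + Q y = T x + b by rewrite /b [RHS]addrC subrK.
clearbody a b.
have := congr1 (fun v => ip v v) eP; have := congr1 (fun v => ip v v) eQ.
rewrite /= !ipE PT QS (ipC x (P x)) (ipC y (Q y)) (ipC a) (ipC b) => e1 e2.
have := ip_ge0 (d%:C *: S y - a); have := ip_ge0 (d%:C *: T x - b).
rewrite !ipE (ipC a) (ipC b) => i1 i2.
have j1 := ip_positive_ge0 x pP; have j2 := ip_positive_ge0 y pQ.
have {j1}j1 := mulr_ge0 (ltW l0) j1; have {j2}j2 := mulr_ge0 (ltW l0) j2.
have h1 : l ^+ 2 * sqnorm x y <=
    2 * (ip (S y) a + ip (T x) b) + sqnorm a b by rewrite /sqnorm; lra.
have h2 : 2 * (ip (S y) a + ip (T x) b) <=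
    d * (ip (S y) (S y) + ip (T x) (T x)) + d^-1 * sqnorm a b.
  rewrite -(ler_pM2l d0) [leRHS]mulrDr (mulrA d d^-1) divff ?gt_eqF // mul1r /sqnorm; lra.
have h3 : d * (ip (S y) (S y) + ip (T x) (T x)) <= l ^+ 2 / 2 * sqnorm x y.
  rewrite -dM -mulrA ler_pM2l // /sqnorm; have := hT x; have := hS y; lra.
have h4 : l ^+ 2 / 2 * sqnorm x y <= (1 + d^-1) * sqnorm a b by lra.
have d1 : 0 <= 1 + d^-1 by rewrite addr_ge0 // invr_ge0 ltW.
have h5 := le_trans h4 (ler_wpM2l d1 abK).
suff : l ^+ 2 / 2 / ((1 + d^-1) * K) * sqnorm x y <= f by rewrite /f; lra.
by rewrite mulrAC ler_pdivrMr // (le_trans h5) // mulrA mulrC.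
Qed.

(* The operators [A (x, y) = (S y, T x)] and [B (x, y) = (P x, Q y)] on [H * H]
   are self-adjoint with [B >= 0] and [B ^ 2 = A ^ 2], so that [A <= B]: if the
   top [l] of the spectrum of [A - B] were positive, an approximate eigenvector
   [z] would satisfy [|A z| ~ |B z + l z| > |B z|]. *)
Lemma mixed_schwarz_pair x y : 2 * ip (T x) y <= ip (P x) x + ip (Q y) y.
Proof.
have bS : exists2 N : R, 0 < N & forall x, rnorm (S x) <= N * rnorm x.
  have [_ hN] := bounded_operatorP (adjointP bT).1.
  suff -> : S = adjoint T by [].
  by apply/funext => v; apply: ip_eq => z; rewrite -TS ip_adjoint.
have [_ [M1 M10 TM]] := bounded_operatorP bT.
have [M2 M20 SM] := bS.
pose M := M1 + M2; have M0 : 0 < M by rewrite addr_gt0.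
have hT v : ip (T v) (T v) <= M ^+ 2 * ip v v.
  rewrite !ipxx -exprMn lerXn2r ?nnegrE ?rnorm_ge0 ?mulr_ge0 ?(ltW M0) ?rnorm_ge0 //.
  by rewrite (le_trans (TM v)) // ler_wpM2r ?rnorm_ge0 // lerDl ltW.
have hS v : ip (S v) (S v) <= M ^+ 2 * ip v v.
  rewrite !ipxx -exprMn lerXn2r ?nnegrE ?rnorm_ge0 ?mulr_ge0 ?(ltW M0) ?rnorm_ge0 //.
  by rewrite (le_trans (SM v)) // ler_wpM2r ?rnorm_ge0 // lerDr ltW.
have amgm (u v : H) : ip u u <= M ^+ 2 * ip v v -> forall w : H,
    2 * `|ip u w| <= M * (ip v v + ip w w).
  move=> uv w; have := ip_ge0 (u - M%:C *: w); have := ip_ge0 (u + M%:C *: w).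
  rewrite !ipE (ipC w u) => h1 h2.
  rewrite -(ler_pM2l M0); case: (ger0P (ip u w)) => _; lra.
have sqn0 u v : 0 <= sqnorm u v by rewrite addr_ge0 ?ip_ge0.
have gainK u v : - gain u v <= 2 * M * sqnorm u v.
  have h1 := amgm _ _ (hT u) v.
  have h2 : 2 * `|ip (P u) u| <= M * (ip u u + ip u u) by apply: amgm; rewrite PT.
  have h3 : 2 * `|ip (Q v) v| <= M * (ip v v + ip v v) by apply: amgm; rewrite QS.
  have := ler_norm (ip (P u) u); have := ler_norm (ip (Q v) v).
  have := ler_norm (- ip (T u) v); rewrite normrN /gain /sqnorm; lra.
have gainM u v : gain u v <= M * sqnorm u v.
  have := amgm _ _ (hT u) v; have := ler_norm (ip (T u) v).
  have := ip_positive_ge0 u pP; have := ip_positive_ge0 v pQ.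
  rewrite /gain /sqnorm; lra.
pose L := [set l : R | 0 <= l /\ forall u v, gain u v <= l * sqnorm u v].
have hL : has_inf L.
  by split; [exists M; split=> //; exact: ltW | exists 0 => l []].
pose l0 := inf L.
have l0_ge0 : 0 <= l0 by apply: lb_le_inf; [case: hL | move=> l []].
have Ll0 u v : gain u v <= l0 * sqnorm u v.
  apply/ler_addgt0Pr => e e0.
  have s1 : 0 < sqnorm u v + 1 by rewrite ltr_wpDl.
  have [l [_ hl] ll] := inf_adherent (divr_gt0 e0 s1) hL.
  rewrite (le_trans (hl u v)) // (le_trans (ler_wpM2r (sqn0 u v) (ltW ll))) //.
  rewrite mulrDl lerD2l -mulrA ler_piMr ?(ltW e0) // mulrC ler_pdivrMr // mul1r.
  by rewrite lerDl.
have [l00|l00] := eqVneq l0 0.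
  by have := Ll0 x y; rewrite l00 mul0r /gain; lra.
have l0p : 0 < l0 by rewrite lt_def l00.
have [c c0 hc] := form_gap M0 l0p hT hS gainK Ll0.
(* An element of [L] below its infimum, since [l0] and [c] are both positive. *)
have : L (Num.max 0 (l0 - c)).
  split; first by rewrite le_max lexx.
  by move=> u v; rewrite (le_trans (hc u v)) // ler_wpM2r // le_max lexx orbT.
have [_ lbL] := hL => /(ge_inf lbL).
rewrite -/l0 le_max [l0 <= 0]leNgt l0p /= => h; lra.
Qed.

(** A phase on the first argument turns the real part of [dot (T x) x] into its modulus and leaves
    the form of [P] unchanged. *)
Lemma mixed_schwarz x : 2 * rnorm (dot (T x) x) <= ip (P x) x + ip (Q x) x.
Proof.
have [u u1 ua] := phase (dot (T x) x).
have := mixed_schwarz_pair (u *: x) x.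
have -> : ip (P (u *: x)) (u *: x) = ip (P x) x.
  rewrite /ip (linear_mapZ _ _ lP) dotZl dotZr mulrA rnormX2 u1 expr1n.
  by rewrite rmorph1 mul1r.
by rewrite (linear_mapZ _ _ lT) {1}/ip dotZl ua.
Qed.

End MixedSchwarz.

(** * Bounds on the alpha-norm *)

Section AlphaNorm.
Set Implicit Arguments.
Unset Strict Implicit.
Context {R : realType} {H : hilbertType R}.
Implicit Types (x y z : H) (T S P Q U V : H -> H).

(* At the unit vector with coordinates [p] and [s * u], the quadratic form of
   the matrix [[a, b], [c, a - e]] takes the value [a] again. *)
Lemma transpose_rotation (b e : R[i]) (c : R) :
  exists u : R[i], exists p s : R, [/\ u * u^* = 1, p ^+ 2 + s ^+ 2 = 1 &
    p%:C * (u^* * c%:C + u * b) = s%:C * e].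
Proof.
have [->|e0] := eqVneq e 0.
  exists 1, 0, 1; rewrite rmorph1 mulr1 mulr0; split=> //; last by rewrite mul0r.
  by rewrite expr0n add0r expr1n.
(* Since [u c e] and [u^* c e^*] are conjugate, this [u] makes [u^* c e^* + u b e^*] a real number
   [r]. Multiplied by [e^*], the required equation becomes [p r = s k]. *)
have [u u1 uh] := phase (b * e^* - c%:C * e).
pose k := rnorm e ^+ 2.
have k0 : 0 < k.
  rewrite exprn_gt0 // lt_def rnorm_ge0 andbT.
  apply: contra_neq e0; exact: rnorm0_eq0.
pose r := complex.Re ((u^* * c%:C + u * b) * e^*).
have re : (u^* * c%:C + u * b) * e^* = r%:C.
  move/(congr1 (@complex.Im R)): uh; rewrite /r; clear r k k0 u1 e0.
  case: u => u1 u2; case: b => b1 b2; case: e => e1 e2 /= h.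
  apply/eqP; rewrite eq_complex /= eqxx /=; apply/eqP; lra.
have D0 : 0 < k ^+ 2 + r ^+ 2 by have := exprn_gt0 2 k0; have := sqr_ge0 r; lra.
pose D := Num.sqrt (k ^+ 2 + r ^+ 2).
have Dp : 0 < D by rewrite sqrtr_gt0.
exists u, (k / D), (r / D); split.
- by rewrite rnormX2 u1 expr1n rmorph1.
- by rewrite !expr_div_n -mulrDl sqr_sqrtr ?(ltW D0) // divff // gt_eqF.
- have ek : e * e^* = k%:C by rewrite rnormX2.
  have ec0 : e^* != 0 by rewrite conjC_eq0.
  apply: (mulIf ec0); rewrite -mulrA re -[RHS]mulrA ek -!rmorphM /=.
  by congr (_%:C); ring.
Qed.

Lemma bessel2 v z w : dot z z = 1 -> dot w w = 1 -> dot z w = 0 ->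
  rnorm (dot v z) ^+ 2 + rnorm (dot v w) ^+ 2 <= rnorm v ^+ 2.
Proof.
move=> z1 w1 zw; have wz : dot w z = 0 by rewrite dotC zw rmorph0.
pose q := v + (- dot v z) *: z + (- dot v w) *: w.
have : (0 : R[i]) <= dot q q by rewrite dotxx ler0c exprn_ge0 // rnorm_ge0.
have -> : dot q q = dot v v - dot v z * (dot v z)^* - dot v w * (dot v w)^*.
  rewrite /q !(dotDl, dotDr, dotZl, dotZr) z1 w1 zw wz.
  by rewrite (dotC z v) (dotC w v) !rmorphN /=; ring.
by rewrite !rnormX2 dotxx -!rmorphB ler0c /= => h; lra.
Qed.

(* Compress [T] to the span of [x] and [T x]: a 2 x 2 matrix is unitarily
   equivalent to its transpose. *)
Lemma adjoint_alpha_vector T x : bounded_operator T -> rnorm x = 1 ->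
  exists z, [/\ rnorm z = 1, dot (T z) z = dot (T x) x &
    rnorm (T x) <= rnorm (adjoint T z)].
Proof.
move=> bT x1; have lT : linear T := bT.1.
have [_ aT] := adjointP bT.
have xx : dot x x = 1 by rewrite dotxx x1 expr1n rmorph1.
pose a := dot (T x) x; pose v := T x - a *: x.
have Tx : T x = a *: x + v by rewrite addrC subrK.
have vx : dot v x = 0.
  by rewrite /v -scaleNr dotDl dotZl xx mulr1 subrr.
have [v0|v0] := eqVneq (rnorm v) 0.
  exists x; split=> //; rewrite Tx (rnorm0_eq0 v0) addr0 rnormZ x1 mulr1 /a aT.
  by rewrite (le_trans (cauchy_schwarz_dot _ _)) // x1 mul1r.
pose c := rnorm v; pose y := (c^-1)%:C *: v.
have vy : v = c%:C *: y by rewrite /y scalerA -rmorphM divff // scale1r.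
have yx : dot y x = 0 by rewrite dotZl vx mulr0.
have xy : dot x y = 0 by rewrite dotC yx rmorph0.
have yy : dot y y = 1.
  rewrite dotxx rnormZ rnormC ger0_norm ?invr_ge0 ?rnorm_ge0 // mulVf //.
  by rewrite expr1n rmorph1.
clearbody y.
have Txx : dot (T x) x = a by [].
have Txy : dot (T x) y = c%:C.
  by rewrite Tx vy dotDl !dotZl xy yy mulr0 add0r mulr1.
pose b := dot (T y) x; pose d := dot (T y) y.
have [u [p [s [uu ps hu]]]] := transpose_rotation b (a - d) c.
have psC : p%:C * p%:C + s%:C * s%:C = 1 :> R[i].
  by rewrite -!rmorphM -rmorphD /= -!expr2 ps.
(* In the orthonormal basis [z], [w] the compression of [T] keeps its first diagonal entry [a],
   while [dot (T w) z] acquires the modulus [c] of [dot (T x) y]. Bessel's inequality then bounds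
   the squared norm of [adjoint T z] below by [|a|^2 + c^2 = |T x|^2]. *)
pose z := p%:C *: x + (s%:C * u) *: y.
pose w := - (s%:C * u^*) *: x + p%:C *: y.
have conjR (t : R) : (t%:C : R[i])^* = t%:C by rewrite conj_Creal // complex_real.
have zz : dot z z = 1.
  rewrite /z !(dotDl, dotDr, dotZl, dotZr) xx yy xy yx !rmorphM /= !conjR.
  rewrite -[RHS]psC; transitivity (p%:C * p%:C + s%:C * s%:C * (u * u^*)).
    by ring.
  by rewrite uu mulr1.
have ww : dot w w = 1.
  rewrite /w !(dotDl, dotDr, dotZl, dotZr) xx yy xy yx.
  rewrite !rmorphN /= !rmorphM /= !conjR conjCK.
  rewrite -[RHS]psC; transitivity (p%:C * p%:C + s%:C * s%:C * (u * u^*)).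
    by ring.
  by rewrite uu mulr1.
have zw : dot z w = 0.
  rewrite /z /w !(dotDl, dotDr, dotZl, dotZr) xx yy xy yx.
  rewrite !rmorphN /= !rmorphM /= !conjR conjCK.
  by ring.
have Tzz : dot (T z) z = a.
  rewrite /z (linear_mapD _ _ lT) !(linear_mapZ _ _ lT) !(dotDl, dotDr, dotZl, dotZr).
  rewrite !rmorphM /= !conjR Txx Txy -/b -/d.
  transitivity (p%:C * p%:C * a + s%:C * (p%:C * (u^* * c%:C + u * b))
                + s%:C * s%:C * (u * u^*) * d); first by ring.
  rewrite hu uu; transitivity ((p%:C * p%:C + s%:C * s%:C) * a); first by ring.
  by rewrite psC mul1r.
have Twz : dot (T w) z = - (u^* * u^* * c%:C).
  rewrite /z /w (linear_mapD _ _ lT) !(linear_mapZ _ _ lT) !(dotDl, dotDr, dotZl, dotZr).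
  rewrite !rmorphM /= !conjR Txx Txy -/b -/d.
  transitivity (u^* * (p%:C * p%:C * (u * b) - s%:C * s%:C * (u^* * c%:C)
     - p%:C * (s%:C * (a - d))) + (1 - u * u^*) * p%:C * p%:C * b); first by ring.
  rewrite -hu uu; transitivity (- ((p%:C * p%:C + s%:C * s%:C) * (u^* * u^* * c%:C))).
    by ring.
  by rewrite psC mul1r.
exists z; split=> //.
  by apply: (@complexI R); rewrite rnormE /ip zz /= sqrtr1.
have u1 : rnorm u = 1.
  have : rnorm u ^+ 2 = 1 by apply: (@complexI R); rewrite -rnormX2 uu rmorph1.
  by move/eqP; rewrite -[X in _ == X](expr1n _ 2) eqrXn2 ?rnorm_ge0 // => /eqP.
have := bessel2 (adjoint T z) zz ww zw.
rewrite (dotC _ z) (dotC _ w) -!aT Tzz Twz !rnorm_conj rnormN !rnormM !rnorm_conj u1.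
rewrite !mul1r rnormC ger0_norm ?rnorm_ge0 // => h.
rewrite -(@ler_pXn2r _ 2) ?nnegrE ?rnorm_ge0 //; apply: le_trans h.
suff : dot (T x) (T x) = (rnorm a ^+ 2 + c ^+ 2)%:C.
  by rewrite dotxx => /complexI ->.
rewrite {2}Tx dotDr dotZr vy dotZr Txy -/a mulrC rnormX2 conjR.
by rewrite -rmorphM -rmorphD -expr2.
Qed.

(** * Moduli, operator norms and real parts *)

Lemma abs_operatorP T : bounded_operator T ->
  positive_operator (abs_operator T) /\
  abs_operator T \o abs_operator T = adjoint T \o T.
Proof.
move=> bT; have [bS aT] := adjointP bT.
suff /sqrt_exists : positive_operator (adjoint T \o T) by exact: xgetPex.
apply: positive_operatorI => [|x y|x]; first exact: bounded_operator_comp.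
  by rewrite /= ipC -!ip_adjoint // ipC.
by rewrite /= ipC -ip_adjoint // ip_ge0.
Qed.

Lemma ip_abs_operator T x : bounded_operator T ->
  ip (abs_operator T x) (abs_operator T x) = ip (T x) (T x).
Proof.
move=> bT; have [pP /(congr1 (@^~ x)) /= PP] := abs_operatorP bT.
by rewrite -positive_selfadjoint // PP ipC -ip_adjoint.
Qed.

(** Nonnegativity of [C] covers the space 0, whose unit sphere is empty. *)
Lemma sup_le_nneg (A : set R) (C : R) : 0 <= C -> ubound A C -> sup A <= C.
Proof.
move=> C0 AC; have [->|/set0P A0] := eqVneq A set0; first by rewrite sup0.
exact: ge_sup.
Qed.

Lemma opnorm_le T (C : R) :
  0 <= C -> (forall x, rnorm x = 1 -> rnorm (T x) <= C) -> opnorm T <= C.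
Proof. by move=> C0 TC; apply: sup_le_nneg => // _ [x /TC ? <-]. Qed.

Lemma le_opnorm T x : bounded_operator T -> rnorm x = 1 -> rnorm (T x) <= opnorm T.
Proof.
move=> [_ [M hM]] x1; apply: ub_le_sup; last by exists x.
by exists M => _ [y y1 <-]; rewrite (le_trans (hM y)) // y1 mulr1.
Qed.

Lemma opnorm_ge0 T : 0 <= opnorm T.
Proof.
have [A0|/set0P[r Ar]] := eqVneq [set rnorm (T x) | x in unit_sphere (H := H)] set0.
  by rewrite /opnorm A0 sup0.
rewrite /opnorm; have [bA|nA] := pselect (has_ubound [set rnorm (T x) | x in unit_sphere]).
  by rewrite (le_trans _ (ub_le_sup bA Ar)) //; case: Ar => x _ <-; exact: rnorm_ge0.
(* The supremum of an unbounded set is 0 by convention. *)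
by rewrite sup_out // => -[].
Qed.

Lemma ip_le_opnorm T x : bounded_operator T -> rnorm x = 1 -> ip (T x) x <= opnorm T.
Proof.
move=> bT x1; rewrite (le_trans (cauchy_schwarz _ _)) // x1 mulr1.
exact: le_opnorm.
Qed.

Lemma ip_real_part T x : bounded_operator T -> ip (real_part T x) x = ip (T x) x.
Proof.
move=> bT; have -> : real_part T x = (2^-1)%:C *: (T x + adjoint T x).
  by rewrite /real_part scalrfctE addrfctE fmorphV rmorph_nat.
by rewrite ipZl ipDl (ipC (adjoint T x)) -ip_adjoint //; field.
Qed.

Lemma bounded_real_part T : bounded_operator T -> bounded_operator (real_part T).
Proof.
move=> bT; apply: bounded_operatorZ; apply: bounded_operatorD => //.
by case: (adjointP bT).
Qed.

(** The vector estimate is stated for abstract [P], [Q], [U] and [r] because it is used twice, the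
    second time with the two moduli exchanged and the same [U]. *)
Lemma pointwise_bound P Q U (alpha r : R) x :
  positive_operator P -> positive_operator Q -> bounded_operator U ->
  ip (U x) x = ip (P x) (Q x) -> rnorm x = 1 -> 0 <= alpha <= 1 ->
  0 <= r -> 2 * r <= ip (P x) x + ip (Q x) x ->
  alpha * r ^+ 2 + (1 - alpha) * ip (P x) (P x) <=
  opnorm ((1 - 3 * alpha / 4)%:C *: (P \o P) + (alpha / 4)%:C *: (Q \o Q))
  + alpha / 2 * opnorm (real_part U).
Proof.
move=> pP pQ bU UPQ x1 /andP[a0 a1] r0 hr.
have bW : bounded_operator
    ((1 - 3 * alpha / 4)%:C *: (P \o P) + (alpha / 4)%:C *: (Q \o Q)).
  apply: bounded_operatorD; apply: bounded_operatorZ; apply: bounded_operator_comp.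
  - exact: pP.1.
  - exact: pP.1.
  - exact: pQ.1.
  - exact: pQ.1.
have := ip_le_opnorm bW x1.
rewrite addrfctE !scalrfctE /= ipDl !ipZl.
rewrite (positive_selfadjoint _ _ pP) (positive_selfadjoint _ _ pQ) => h1.
have := ip_le_opnorm (bounded_real_part bU) x1; rewrite ip_real_part // UPQ => h2.
have h3 : 2 * r <= rnorm (P x + Q x).
  by rewrite (le_trans hr) // -ipDl (le_trans (cauchy_schwarz _ _)) // x1 mulr1.
have h4 : 4 * r ^+ 2 <= ip (P x) (P x) + ip (Q x) (Q x) + 2 * ip (P x) (Q x).
  have -> : ip (P x) (P x) + ip (Q x) (Q x) + 2 * ip (P x) (Q x) =
    rnorm (P x + Q x) ^+ 2 by rewrite -ipxx !ipE (ipC (Q x) (P x)); ring.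
  have := rnorm_ge0 (P x + Q x); nra.
have h5 := ler_wpM2l a0 h4; have h6 := ler_wpM2l a0 h2.
lra.
Qed.

Lemma pointwise_bounds T (alpha : R) x :
  let P := abs_operator T in let Q := abs_operator (adjoint T) in
  bounded_operator T -> rnorm x = 1 -> 0 <= alpha <= 1 ->
  let lhs := alpha * rnorm (dot (T x) x) ^+ 2 + (1 - alpha) * rnorm (T x) ^+ 2 in
  lhs <= opnorm ((1 - 3 * alpha / 4)%:C *: (P \o P) + (alpha / 4)%:C *: (Q \o Q))
         + alpha / 2 * opnorm (real_part (P \o Q)) /\
  lhs <= opnorm ((1 - 3 * alpha / 4)%:C *: (Q \o Q) + (alpha / 4)%:C *: (P \o P))
         + alpha / 2 * opnorm (real_part (P \o Q)).
Proof.
move=> P Q bT x1 a01 /=.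
have [bS aT] := adjointP bT.
have [pP _] := abs_operatorP bT; have [pQ _] := abs_operatorP bS.
have PT y : ip (P y) (P y) = ip (T y) (T y) by exact: ip_abs_operator.
have QS y : ip (Q y) (Q y) = ip (adjoint T y) (adjoint T y) by exact: ip_abs_operator.
have bPQ : bounded_operator (P \o Q) := bounded_operator_comp pP.1 pQ.1.
have schwarz y : 2 * rnorm (dot (T y) y) <= ip (P y) y + ip (Q y) y.
  by apply: (mixed_schwarz bT _ pP pQ PT QS) => u v; exact: ip_adjoint.
have UPQ y : ip ((P \o Q) y) y = ip (P y) (Q y).
  by rewrite /= (positive_selfadjoint _ _ pP) ipC.
split; first by rewrite -(ipxx (T x)) -PT; apply: pointwise_bound => //; exact: rnorm_ge0.
(* The second bound is proved at [z] instead of [x]: the numerical value is the same and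
   [|T x| <= |Q z|]. *)
have [z [z1 Tz Tx]] := adjoint_alpha_vector bT x1.
apply: (@le_trans _ _ (alpha * rnorm (dot (T z) z) ^+ 2 + (1 - alpha) * ip (Q z) (Q z))).
  rewrite Tz lerD2l QS ipxx ler_wpM2l ?subr_ge0 ?(andP a01).2 //.
  by rewrite lerXn2r ?nnegrE ?rnorm_ge0.
apply: pointwise_bound => //; first by rewrite UPQ ipC.
  exact: rnorm_ge0.
by rewrite addrC.
Qed.

(** * Existence of the minima *)

Lemma opnorm_affine_lipschitz U V : bounded_operator U -> bounded_operator V ->
  exists2 L : R, 0 < L & forall s t : R,
  opnorm ((1 - 3 * s / 4)%:C *: U + (s / 4)%:C *: V) <=
  opnorm ((1 - 3 * t / 4)%:C *: U + (t / 4)%:C *: V) + L * `|s - t|.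
Proof.
move=> bU bV.
have [_ [M M0 hM]] := bounded_operatorP bU; have [_ [N N0 hN]] := bounded_operatorP bV.
exists (M + N) => [|s t]; first exact: addr_gt0.
have bW : bounded_operator ((1 - 3 * t / 4)%:C *: U + (t / 4)%:C *: V).
  by apply: bounded_operatorD; exact: bounded_operatorZ.
apply: opnorm_le => [|x x1].
  by rewrite addr_ge0 ?opnorm_ge0 // mulr_ge0 // ltW // addr_gt0.
have := le_opnorm bW x1; rewrite !addrfctE !scalrfctE => h1.
have -> : (1 - 3 * s / 4)%:C *: U x + (s / 4)%:C *: V x =
    ((1 - 3 * t / 4)%:C *: U x + (t / 4)%:C *: V x) +
    ((s - t)%:C *: ((4^-1)%:C *: V x - (3 / 4)%:C *: U x)).
  by apply: ip_eq => w; rewrite !ipE; field.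
rewrite (le_trans (rnormD _ _)) // lerD // rnormZ rnormC mulrC ler_wpM2r //.
have := rnormD ((4^-1)%:C *: V x) (- ((3 / 4)%:C *: U x)).
rewrite rnormN !rnormZ !rnormC !ger0_norm ?invr_ge0 ?divr_ge0 // => h2.
have := hM x; have := hN x; rewrite x1 !mulr1 => h3 h4; lra.
Qed.

Lemma lipschitz_sqrt_min (B : R -> R) (L : R) : 0 < L ->
  (forall s t, B s <= B t + L * `|s - t|) ->
  exists2 c : R, 0 <= c <= 1 &
    is_minimum [set Num.sqrt (B t) | t in `[0, 1]] (Num.sqrt (B c)).
Proof.
move=> L0 BL.
have cB : {within `[0, 1], continuous B}.
  apply: continuous_subspaceT => t; apply/cvgrPdist_lt => e e0.
  have tt : (fun s : R => s) @ t --> t by exact: cvg_id.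
  have /cvgrPdist_lt /(_ _ (divr_gt0 e0 L0)) near_t := tt.
  near=> s.
  have st : `|t - s| < e / L by near: s; exact: near_t.
  have h : L * `|t - s| < e by rewrite mulrC -ltr_pdivlMr.
  have := BL s t; have := BL t s; rewrite (distrC s t) ltr_norml => h1 h2.
  by apply/andP; split; lra.
have [c c01 hc] := EVT_min ler01 cB.
exists c; first by move: c01; rewrite in_itv.
split; first by exists c.
by move=> _ [t t01 <-]; rewrite ler_wsqrtr // hc.
Unshelve. all: by end_near. Qed.

Lemma bound_sqrt_min U V (k : R) : bounded_operator U -> bounded_operator V -> 0 <= k ->
  let B (t : R) :=
    opnorm ((1 - 3 * t / 4)%:C *: U + (t / 4)%:C *: V) + t / 2 * k in
  exists2 c : R, 0 <= c <= 1 &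
    is_minimum [set Num.sqrt (B t) | t in `[0, 1]] (Num.sqrt (B c)).
Proof.
move=> bU bV k0 B; have [L L0 hL] := opnorm_affine_lipschitz bU bV.
apply: (@lipschitz_sqrt_min _ (L + k)) => [|s t]; first exact: ltr_pwDl.
have := hL s t; have := ler_wpM2r k0 (ler_norm (s - t)).
have := mulr_ge0 (normr_ge0 (s - t)) k0; rewrite /B; lra.
Qed.

(** * From pointwise bounds to suprema *)

Lemma sup_le_sqrt (A : set R) (C : R) :
  0 <= C -> (forall r, A r -> 0 <= r /\ r ^+ 2 <= C) -> sup A <= Num.sqrt C.
Proof.
move=> C0 AC; apply: sup_le_nneg => [|r /AC[r0 rC]]; first exact: sqrtr_ge0.
by rewrite -(ger0_norm r0) -sqrtr_sqr ler_wsqrtr.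
Qed.

(** The numerical radius obeys the same bound because [|<Tx,x>| <= |Tx|] on the unit sphere, so that
    the convex combination dominates [|<Tx,x>|^2]. *)
Lemma alpha_norm_le T (alpha C : R) : 0 <= alpha <= 1 -> 0 <= C ->
  (forall x, rnorm x = 1 ->
    alpha * rnorm (dot (T x) x) ^+ 2 + (1 - alpha) * rnorm (T x) ^+ 2 <= C) ->
  alpha_norm alpha T ^+ 2 <= C /\ numerical_radius T <= Num.sqrt C.
Proof.
case/andP=> a0 a1 C0 hC; have b0 : 0 <= 1 - alpha by rewrite subr_ge0.
split.
  have an0 : 0 <= alpha_norm alpha T.
    rewrite /alpha_norm; set A := (X in sup X).
    have [->|/set0P[r Ar]] := eqVneq A set0; first by rewrite sup0.
    have ubA : ubound A (Num.sqrt C).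
      by move=> _ [x x1 <-]; rewrite ler_wsqrtr // hC.
    apply: (@le_trans _ _ r); first by case: Ar => x _ <-; exact: sqrtr_ge0.
    by apply: ub_le_sup => //; exists (Num.sqrt C).
  rewrite -[leRHS](sqr_sqrtr C0) lerXn2r ?nnegrE ?sqrtr_ge0 //.
  apply: sup_le_sqrt => // _ [x x1 <-]; split; first exact: sqrtr_ge0.
  rewrite sqr_sqrtr ?hC //.
  by apply: addr_ge0; apply: mulr_ge0 => //; exact: sqr_ge0.
apply: sup_le_sqrt => // _ [x x1 <-]; split; first exact: rnorm_ge0.
apply: le_trans (hC x x1).
have := cauchy_schwarz_dot (T x) x; rewrite x1 mulr1 => h.
have /(ler_wpM2l b0) : rnorm (dot (T x) x) ^+ 2 <= rnorm (T x) ^+ 2.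
  by rewrite lerXn2r ?nnegrE ?rnorm_ge0.
lra.
Qed.

End AlphaNorm.

Theorem corollary2p2 (R : realType) (H : hilbertType R) (T : H -> H)
    (hT : bounded_operator T) :
  let absT := abs_operator T in
  let absTs := abs_operator (adjoint T) in
  let B1 (alpha : R) : R :=
    opnorm ((1 - 3 * alpha / 4)%:C *: (absT \o absT)
            + (alpha / 4)%:C *: (absTs \o absTs))
    + alpha / 2 * opnorm (real_part (absT \o absTs)) in
  let B2 (alpha : R) : R :=
    opnorm ((1 - 3 * alpha / 4)%:C *: (absTs \o absTs)
            + (alpha / 4)%:C *: (absT \o absT))
    + alpha / 2 * opnorm (real_part (absT \o absTs)) in
  (forall alpha : R, 0 <= alpha <= 1 ->
     alpha_norm alpha T ^+ 2 <= B1 alpha /\ alpha_norm alpha T ^+ 2 <= B2 alpha)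
  /\
  exists gamma delta : R,
    [/\ is_minimum [set Num.sqrt (B1 alpha) | alpha in `[0, 1]] gamma,
        is_minimum [set Num.sqrt (B2 alpha) | alpha in `[0, 1]] delta &
        numerical_radius T <= Num.min gamma delta].
Proof.
move=> absT absTs B1 B2.
have [hS _] := adjointP hT.
have bP : bounded_operator (absT \o absT).
  by have [[bP _] _] := abs_operatorP hT; exact: bounded_operator_comp.
have bQ : bounded_operator (absTs \o absTs).
  by have [[bQ _] _] := abs_operatorP hS; exact: bounded_operator_comp.
have k0 := opnorm_ge0 (real_part (absT \o absTs)).
have bounds alpha : 0 <= alpha <= 1 ->
    (alpha_norm alpha T ^+ 2 <= B1 alpha /\ numerical_radius T <= Num.sqrt (B1 alpha)) /\
    (alpha_norm alpha T ^+ 2 <= B2 alpha /\ numerical_radius T <= Num.sqrt (B2 alpha)).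
  move=> a01; have /andP[a0 _] := a01.
  have B_ge0 (W : H -> H) : 0 <= opnorm W + alpha / 2 * opnorm (real_part (absT \o absTs)).
    by apply: addr_ge0; [exact: opnorm_ge0 | apply: mulr_ge0 => //; exact: divr_ge0].
  split; (apply: alpha_norm_le => //; first exact: B_ge0) => x x1;
    by case: (pointwise_bounds hT x1 a01).
split=> [alpha /bounds[[h1 _] [h2 _]] //|].
have [c1 /bounds[[_ w1] _] m1] := bound_sqrt_min bP bQ k0.
have [c2 /bounds[_ [_ w2]] m2] := bound_sqrt_min bQ bP k0.
exists (Num.sqrt (B1 c1)), (Num.sqrt (B2 c2)); split=> //.
by rewrite le_min w1.
Qed.
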